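(* Let $s>0$ be an odd integer. There is a bijection between the set of order ideals of the poset $P_{s,s+2}$ that contain no two consecutive integers and the set of lattice paths of length $s$ from $(0,0)$ to $(s,y)$, where $y$ ranges over the positive integers.
   Context: $\mathbb{N}$ denotes the non-negative integers. For positive integers $s,t$, let $P_{s,t}=\mathbb{N}\setminus\{as+bt : a,b\in\mathbb{N}\}$, partially ordered as the reflexive-transitive closure of the covering relation: $x$ covers $y$ iff $x-y\in\{s,t\}$. An order ideal of a poset $P$ is a subset $I$ such that $y\in I$ and $x\le y$ imply $x\in I$. A lattice path of length $n$ is a path in $\mathbb{Z}\times\mathbb{Z}$ from $(0,0)$ to $(n,y)$ for some $y\in\mathbb{Z}$ using steps $(1,1)$ and $(1,-1)$. *)

(* Defs.v *)
From Stdlib Require Import Relation_Operators.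
From mathcomp Require Import all_boot all_order all_algebra.
From mathcomp Require Import classical_sets functions.

Set Implicit Arguments.
Unset Strict Implicit.
Unset Printing Implicit Defensive.

Import Order.TTheory GRing.Theory Num.Theory.

Local Open Scope classical_set_scope.

Definition Pst (s t : nat) : set nat :=
  [set x | ~ exists a b : nat, x = (a * s + b * t)%N].

Definition covered (s t : nat) (y x : nat) : Prop :=
  [/\ Pst s t y, Pst s t x & x = (y + s)%N \/ x = (y + t)%N].

(* A relation on all of nat; outside Pst s t it only relates x to itself. *)
Definition lePst (s t : nat) : nat -> nat -> Prop :=
  clos_refl_trans nat (covered s t).

Definition order_ideal (s t : nat) (I : set nat) : Prop :=
  I `<=` Pst s t /\ forall x y : nat, I y -> lePst s t x y -> I x.

Definition no_consecutive (I : set nat) : Prop :=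
  forall x : nat, ~ (I x /\ I x.+1).

Definition step (u v : int * int) : bool :=
  (v == (u.1 + 1, u.2 + 1)%R) || (v == (u.1 + 1, u.2 - 1)%R).

(* p lists the vertices visited after the starting point (0, 0). *)
Definition lattice_path (n : nat) (y : int) (p : seq (int * int)) : Prop :=
  [/\ size p = n, path step (0, 0)%R p & last (0, 0)%R p = (Posz n, y)].

(* Main.v *)
(** Let s = 2k+1.  An ideal I of P_{s,s+2} is a set avoiding 0 and closed under
    subtracting s and s+2, so it is given by the heights
    h_j = #{q : qs + j in I} for j < s.  In terms of heights: h_0 = 0,
    h_{j+2} <= h_j + 1, h_1 <= h_{s-1} + 2 (wrap-around), and having no two
    consecutive elements means h_j h_{j+1} = 0.  For a fixed h_1 = p the
    sequences with h_{s-1} >= p - 2 are counted by reading them from left to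
    right; Pascal's rule shows that there are C(s, p+k) of them when p >= 2,
    and C(s, k+1) for p = 0 and p = 1 together.  These are the numbers of paths
    with k+1, k+2, ..., s up steps, i.e. of those ending at a positive height. *)

From Stdlib Require Import Relation_Operators.
Require Import Defs.
From mathcomp Require Import all_boot all_order all_algebra.
From mathcomp Require Import zify.
From mathcomp Require Import boolp classical_sets functions.

Set Implicit Arguments.
Unset Strict Implicit.
Unset Printing Implicit Defensive.

Local Open Scope classical_set_scope.
Local Open Scope nat_scope.

(** * Counting the tails of height sequences *)

(* [t] may follow the entries [a], [b] of a height sequence, and the last entry
   of the whole is at least [m]. *)
Fixpoint valid (m a b : nat) (t : seq nat) : bool :=
  if t is c :: t' then [&& c < a.+2, b * c == 0 & valid m b c t'] else m <= b.

Fixpoint tails (m n a b : nat) : seq (seq nat) :=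
  if n is n'.+1 then
    [seq c :: t | c <- [seq c <- iota 0 a.+2 | b * c == 0], t <- tails m n' b c]
  else nseq (m <= b) [::].

Lemma tailsS m n a b :
  tails m n.+1 a b =
  [seq c :: t | c <- [seq c <- iota 0 a.+2 | b * c == 0], t <- tails m n b c].
Proof. by []. Qed.

(* The number of continuations of length [n - 1] of the entries [p], [0]; the
   factor [m <= p + n] only matters at [n = 0], where 'C(p - m, 0) = 1. *)
Definition ntails (m p n : nat) : nat :=
  if odd n then 'C(p + n - m, (p + n./2).+1)
  else (m <= p + n) * 'C(p + n - m, n./2).

Lemma mem_tails m n a b t :
  (t \in tails m n a b) = (size t == n) && valid m a b t.
Proof.
elim: n a b t => [|n IHn] a b t.
  by case: t => [|c t] /=; case: (m <= b); rewrite ?in_cons.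
rewrite tailsS; apply/allpairsPdep/idP => [[c [u [+ + ->]]]|].
  by rewrite mem_filter mem_iota IHn /= => /andP[-> ->] /andP[/eqP-> ->] /[!eqxx].
case: t => [//|c u]; rewrite eqSS => /andP[su /and3P[c_lt bc vu]].
exists c, u; split=> //; first by rewrite mem_filter mem_iota bc.
by rewrite IHn su.
Qed.

Lemma uniq_tails m n a b : uniq (tails m n a b).
Proof.
elim: n a b => [|n IHn] a b; first by rewrite /=; case: (m <= b).
rewrite tailsS; apply: allpairs_uniq_dep => [|c _|[c t] [d u] _ _ /= [-> ->] //].
  exact/filter_uniq/iota_uniq.
exact: IHn.
Qed.

(** Compared with the entries [p], 0, the entries [p.+1], 0 admit one more next entry, [p.+2], which
    accounts for the last term. On the closed forms this is Pascal's rule; for [m > p + n.+2]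
    truncated subtraction blocks the rule, but all terms vanish. *)
Lemma ntailsS m p n : ntails m p.+1 n.+2 = ntails m p n.+2 + ntails m p.+2 n.
Proof.
rewrite /ntails /= negbK; set r := n./2; case: ifP => odd_n.
  have [h|h] := leqP m (p + n.+2).
    have -> : p.+1 + n.+2 - m = (p + n.+2 - m).+1 by lia.
    have -> : p.+2 + n - m = p + n.+2 - m by lia.
    have -> : p.+2 + r = p.+1 + r.+1 by lia.
    by rewrite binS addnC.
  by rewrite !bin_small //; lia.
have -> : p.+2 + n = p + n.+2 by lia.
have [h|h] := leqP m (p + n.+2).
  have -> : p.+1 + n.+2 - m = (p + n.+2 - m).+1 by lia.
  by rewrite leqW ?addSn // !mul1n binS.
by rewrite !mul0n bin_small ?muln0 //; lia.
Qed.

(** After 0, 0 comes 0 or 1. The lengths [n] and [n.+1] have opposite parities, yet the rounding in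
    [./2] makes the two closed forms neighbouring binomials. *)
Lemma ntails0 m n : ntails m 0 n.+2 = ntails m 0 n.+1 + ntails m 1 n.
Proof.
rewrite /ntails /= negbK; case: ifP => odd_n /=; rewrite !add0n !add1n.
  have -> : uphalf n = n./2.+1 by lia.
  have [h|h] := leqP m n.+1.
    by rewrite subSn // mul1n binS addnC.
  by rewrite !bin_small //; lia.
have -> : uphalf n = n./2 by lia.
have [h|h] := leqP m n.+1.
  by rewrite leqW // subSn // !mul1n binS.
by rewrite mul0n addn0 !bin_small ?muln0 //; lia.
Qed.

Lemma ntails_rec m p n :
  ntails m p n.+2 = ntails m 0 n.+1 + \sum_(c < p.+1) ntails m c.+1 n.
Proof.
elim: p => [|p IHp]; first by rewrite big_ord1 ntails0.
by rewrite ntailsS IHp [in RHS]big_ord_recr /= addnA.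
Qed.

(* A positive entry forces the next one to vanish, so one remaining place is
   lost when it is the last entry read. *)
Lemma size_tails m n p :
  size (tails m n p 0) = ntails m p n.+1 /\
  (0 < p -> size (tails m n 0 p) = ntails m p n).
Proof.
have [N] := ubnP n; elim: N => // N IHN in n p *; rewrite ltnS => nN.
have tail0 q n' : n'.+1 < N.+1 ->
    0 < q -> size (tails m n'.+1 0 q) = size (tails m n' q 0).
  move=> _ q0; rewrite /= muln0 muln1 eqxx /=.
  have -> : (q == 0) = false by lia.
  by rewrite cats0 size_map.
split.
  case: n nN => [|n] nN.
    (* Both sides are 1 if [m = 0] and 0 otherwise: the closed form is 'C(p.+1 - m, p.+1). *)
    rewrite /= size_nseq /ntails /= addn0 addn1; case: m {tail0 IHN} => [|m].
      by rewrite subn0 binn.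
    by rewrite bin_small //; lia.
  have -> : size (tails m n.+1 p 0) =
            \sum_(c <- iota 0 p.+2) size (tails m n 0 c).
    rewrite tailsS size_allpairs_dep sumnE big_map.
    by rewrite (eq_filter (a2 := predT)) ?filter_predT.
  rewrite ntails_rec -[iota 0 _]/(index_iota 0 p.+2) big_nat_recl //.
  rewrite (IHN n 0 _).1 // big_mkord; congr (_ + _).
  by apply: eq_bigr => c _; rewrite (IHN n c.+1 _).2.
case: n nN => [|n] nN p0.
  by rewrite /= size_nseq /ntails /= addn0 bin0 muln1.
by rewrite tail0 // (IHN n p _).1.
Qed.

(** * Bit sequences by number of ones *)

Fixpoint bitseqs (n d : nat) : seq bitseq :=
  match n, d with
  | 0, 0 => [:: [::]]
  | 0, _.+1 => [::]
  | n'.+1, 0 => map (cons false) (bitseqs n' 0)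
  | n'.+1, d'.+1 =>
      map (cons false) (bitseqs n' d) ++ map (cons true) (bitseqs n' d')
  end.

Lemma mem_map_cons (T : eqType) (x : T) (l : seq (seq T)) (t : seq T) :
  (t \in map (cons x) l) = if t is y :: t' then (y == x) && (t' \in l) else false.
Proof.
apply/mapP/idP => [[u ul ->]|]; first by rewrite eqxx.
by case: t => // y t /andP[/eqP-> tl]; exists t.
Qed.

Lemma mem_bitseqs n d (t : bitseq) :
  (t \in bitseqs n d) = (size t == n) && (count id t == d).
Proof.
elim: n d t => [|n IHn] [|d] [|b t] //=;
  rewrite ?mem_cat ?mem_map_cons ?IHn //=; case: b => //=;
  by rewrite ?orbF ?add0n ?add1n ?eqSS ?andbF.
Qed.

Lemma uniq_bitseqs n d : uniq (bitseqs n d).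
Proof.
have injc (b : bool) : injective (cons b) by move=> ? ? [].
elim: n d => [|n IHn] [|d] //=; rewrite ?cat_uniq !map_inj_uniq ?IHn //= andbT.
by apply/hasPn => _ /mapP[u _ ->]; rewrite mem_map_cons.
Qed.

Lemma size_bitseqs n d : size (bitseqs n d) = 'C(n, d).
Proof.
by elim: n d => [|n IHn] [|d] //=; rewrite ?size_cat !size_map !IHn ?bin0 ?binS.
Qed.

(** With [true] as an up step, [d] up steps out of 2k+1 lead to height 2d - (2k+1), positive exactly
    for d > k. *)
Definition ups (k : nat) : seq bitseq :=
  [seq t | d <- iota k.+1 k.+1, t <- bitseqs k.*2.+1 d].

Lemma mem_ups k (t : bitseq) :
  (t \in ups k) = (size t == k.*2.+1) && (k < count id t).
Proof.
apply/allpairsPdep/andP => [[d [u [+ + ->]]]|[/eqP st kt]].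
  rewrite mem_iota mem_bitseqs => /andP[kd _] /andP[-> /eqP ->]; split=> //.
exists (count id t), t; rewrite mem_iota mem_bitseqs st !eqxx kt; split=> //.
by have := count_size id t; lia.
Qed.

Lemma uniq_ups k : uniq (ups k).
Proof.
apply: allpairs_uniq_dep => [|d _|]; [exact: iota_uniq|exact: uniq_bitseqs|].
move=> _ _ /allpairsPdep[d [t [_ + ->]]] /allpairsPdep[e [u [_ + ->]]] /= tu.
rewrite !mem_bitseqs tu => /andP[_ /eqP ue] /andP[_ /eqP ud].
by move: ue; rewrite ud => ->.
Qed.

Lemma size_ups k : size (ups k) = \sum_(d < k.+1) 'C(k.*2.+1, k.+1 + d).
Proof.
rewrite size_allpairs_dep sumnE big_map -[X in iota X _]addn0 iotaDl big_map.
rewrite -[iota 0 _]/(index_iota 0 k.+1) big_mkord.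
by apply: eq_bigr => d _; rewrite size_bitseqs.
Qed.

(** * Lattice paths as bit sequences *)

Fixpoint walk (z : int * int) (bs : bitseq) : seq (int * int) :=
  if bs is b :: bs' then
    let v := (z.1 + 1, if b then z.2 + 1 else z.2 - 1)%R in v :: walk v bs'
  else [::].

Lemma size_walk z bs : size (walk z bs) = size bs.
Proof. by elim: bs z => //= b bs IHbs z; rewrite IHbs. Qed.

Lemma last_walk z bs :
  last z (walk z bs) =
  (z.1 + (size bs)%:Z, z.2 + (count id bs).*2%:Z - (size bs)%:Z)%R.
Proof.
elim: bs z => [|b bs IHbs] z /=; first by case: z => x y /=; congr pair; lia.
by rewrite IHbs /=; case: b; congr pair; lia.
Qed.

Lemma path_walk z bs : path step z (walk z bs).
Proof.
elim: bs z => //= b bs IHbs z; rewrite IHbs andbT /step.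
by case: b; rewrite eqxx ?orbT.
Qed.

Lemma walk_inj z : injective (walk z).
Proof.
move=> bs; elim: bs z => [|b bs IHbs] z [|c cs] //= [bc].
have -> : b = c by case: b c bc => [] [] //= bc; lia.
by move=> /IHbs ->.
Qed.

Lemma walk_surj z p : path step z p -> exists bs, p = walk z bs.
Proof.
elim: p z => [|v p IHp] z /=; first by exists [::].
case/andP=> /orP[] /eqP -> /IHp[bs ->].
  by exists (true :: bs).
by exists (false :: bs).
Qed.

Lemma walk_bij k :
  set_bij [set` ups k]
    [set p | exists2 y : int, (0 < y)%R & lattice_path k.*2.+1 y p]
    (walk (0, 0)%R).
Proof.
split=> [bs|bs cs _ _ /walk_inj //|p [y y0 [sp /walk_surj[bs e] lp]]].
  rewrite /= mem_ups => /andP[/eqP st kt].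
  exists ((count id bs).*2%:Z - (size bs)%:Z)%R; first by lia.
  split; [by rewrite size_walk|exact: path_walk|].
  by rewrite last_walk /= st; congr pair; lia.
exists bs; last by [].
move: lp sp; rewrite e size_walk last_walk /= mem_ups => -[_ lp] sp.
by rewrite sp eqxx; lia.
Qed.

(** * Height sequences and their number *)

Lemma validP m a b t :
  valid m a b t <->
  (forall j, j < size t ->
     nth 0 (a :: b :: t) j.+2 <= (nth 0 (a :: b :: t) j).+1 /\
     nth 0 (a :: b :: t) j.+1 * nth 0 (a :: b :: t) j.+2 = 0) /\
  m <= last b t.
Proof.
elim: t a b => [|c t IHt] a b; first by split=> [|[]].
rewrite [valid _ _ _ _]/=; split=> [/and3P[ca /eqP bc /IHt[H ml]]|[H ml]].
  by split=> // -[|j] // /H.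
apply/and3P; split; first by have [] := H 0 isT.
  by apply/eqP; have [] := H 0 isT.
by apply/IHt; split=> // j /(H j.+1).
Qed.

(* For k = 0 the third condition is void, [nth 0 w 1] being the default value. *)
Definition height_seq (k : nat) (w : seq nat) : Prop :=
  [/\ size w = k.*2.+1, nth 0 w 0 = 0, nth 0 w 1 <= (nth 0 w k.*2).+2,
      forall j, j.+1 < k.*2.+1 -> nth 0 w j * nth 0 w j.+1 = 0
    & forall j, j.+2 < k.*2.+1 -> nth 0 w j.+2 <= (nth 0 w j).+1].

(** The wrap-around condition becomes the lower bound [p - 2] on the last entry, void for p <= 2 by
    truncation. *)
Definition height_seqs (k : nat) : seq (seq nat) :=
  if k is r.+1 then
    [seq 0 :: p :: t | p <- iota 0 r.+3, t <- tails (p - 2) r.*2.+1 0 p]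
  else [:: [:: 0]].

(** For p >= 2 the bound [p - 2] cancels [p] in the upper index, leaving 2r+3; at p = 1 truncation
    leaves 2r+2. *)
Lemma size_tails_height r p : 0 < p ->
  size (tails (p - 2) r.*2.+1 0 p) =
  if p == 1 then 'C(r.*2.+2, r.+2) else 'C(r.*2.+3, p + r.+1).
Proof.
move=> p0; rewrite (size_tails _ _ _).2 // /ntails /= odd_double /=.
rewrite uphalf_double -addnS; case: p p0 => [//|[|p]] _ /=.
  by rewrite add1n.
by congr 'C(_, _); lia.
Qed.

Lemma mem_height_seqs k w : w \in height_seqs k <-> height_seq k w.
Proof.
case: k => [|r]; rewrite /height_seqs.
  rewrite inE; split=> [/eqP ->|[+ + _ _ _]]; first by split.
  by case: w => [|a []] //= _ ->.
split=> [/allpairsPdep[p [t [_ + ->]]]|[sw w0 w1 cw iw]].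
  rewrite mem_tails => /andP[/eqP st /validP[H ml]]; split=> //.
  - by rewrite /= st.
  - rewrite doubleS -st -[nth 0 _ (size t).+1]/(nth 0 (p :: t) (size (p :: t)).-1).
    by rewrite nth_last /=; lia.
  - by case=> // j jt; have [] := H j; rewrite ?st; lia.
  - by move=> j jt; have [] := H j; rewrite ?st; lia.
case: w sw w0 w1 cw iw => [//|a [//|p t]]; rewrite doubleS => -[st] a0 w1 cw iw.
have {}a0 : a = 0 by []; subst a.
have tP : t \in tails (p - 2) r.*2.+1 0 p.
  rewrite mem_tails st eqxx; apply/validP; split.
    by move=> j; rewrite st => jt; split; [exact: iw|exact: (cw j.+1)].
  move: w1; rewrite -st.
  by rewrite -[nth _ _ (size t).+1]/(nth 0 (p :: t) (size (p :: t)).-1) nth_last /=; lia.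
apply/allpairsPdep; exists p, t; split=> //; rewrite mem_iota /= add0n.
(* A larger [p] has no tails at all: their number 'C(r.*2.+3, p + r.+1) is zero. *)
have [//|p_gt] := ltnP p r.+3.
have := size_tails_height r (p := p) _; rewrite ifN ?bin_small; [|lia..].
move=> /(_ ltac:(lia)) /size0nil t0; by rewrite t0 in tP.
Qed.

Lemma uniq_height_seqs k : uniq (height_seqs k).
Proof.
case: k => [//|r]; rewrite /height_seqs.
apply: allpairs_uniq_dep => [|p _|[p t] [q u] _ _ /= [-> ->] //].
  exact: iota_uniq.
exact: uniq_tails.
Qed.

Lemma size_height_seqs k : size (height_seqs k) = size (ups k).
Proof.
rewrite size_ups; case: k => [|r]; first by rewrite big_ord1.
rewrite size_allpairs_dep sumnE big_map -[iota 0 _]/(index_iota 0 r.+3).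
(* The terms p = 0 and p = 1 merge by Pascal's rule into the term of k+1 up steps; afterwards p
   matches p+k up steps. *)
rewrite big_mkord 2!big_ord_recl [in RHS]big_ord_recl addnA; congr (_ + _).
  rewrite (size_tails _ _ _).1 size_tails_height // /ntails /= odd_double /=.
  by rewrite mul1n add0n subn0 doubleK addn0 doubleS binS addnC.
apply: eq_bigr => d _; rewrite size_tails_height //=.
by congr 'C(_, _); rewrite /= /bump /=; lia.
Qed.

Lemma uniq_set_bij (T : eqType) (U : eqType) (x0 : U) (a : seq T) (b : seq U) :
  uniq a -> uniq b -> size a = size b ->
  set_bij [set` a] [set` b] (fun x => nth x0 b (index x a)).
Proof.
move=> ua ub sab; split=> [x /= xa|x y|y /= yb].
- by rewrite mem_nth // -sab index_mem.
- rewrite !inE /= => xa ya /eqP; rewrite nth_uniq -?sab ?index_mem // => /eqP.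
  exact: index_inj.
- have yb' : index y b < size a by rewrite sab index_mem.
  (* The list is nonempty, and its head serves as the default value for [nth]. *)
  case: a => [//|z a] in ua sab yb' *.
  exists (nth z (z :: a) (index y b)); first exact: mem_nth.
  by rewrite index_uniq // nth_index.
Qed.

(** * Order ideals as height sequences *)

(** Excluding 0 keeps the ideal inside the poset: from a representable element, subtracting [s] and
    [t] would lead down to 0. Conversely, x is in the poset if x + s or x + t is, since adding a
    generator preserves representability. *)
Lemma order_idealP s t (I : set nat) :
  order_ideal s t I <->
  [/\ ~ I 0, forall x, I (x + s) -> I x & forall x, I (x + t) -> I x].
Proof.
split=> [[IP Icl]|[I0 Is It]].
  have down d x : (forall a b, exists a' b', a * s + b * t + d = a' * s + b' * t) ->
      d = s \/ d = t -> I (x + d) -> I x.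
    move=> rep dst Ixd; apply: (Icl _ _ Ixd); apply: rt_step.
    split; [|exact: IP|by case: dst => ->; [left|right]].
    move=> [a [b xE]]; apply: (IP _ Ixd).
    by have [a' [b' e]] := rep a b; exists a', b'; rewrite xE.
  split=> [/IP|x|x]; first by apply; exists 0, 0.
    by apply: down; [move=> a b; exists a.+1, b; rewrite mulSn; lia|left].
  by apply: down; [move=> a b; exists a, b.+1; rewrite mulSn; lia|right].
split=> [x Ix [a [b xE]]|x y Iy xy].
  apply: I0; rewrite {}xE in Ix; elim: a Ix => [|a IHa].
    elim: b => // b IHb; rewrite mul0n add0n mulSn addnC => /It.
    by rewrite -[b * t]add0n -[0](mul0n s).
  by rewrite mulSn -addnA addnC => /Is.
elim: xy Iy => {x y} [x y [_ _ [] -> ]|//|x y z _ IHxy _ IHyz /IHyz/IHxy //].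
  exact: Is.
exact: It.
Qed.

Definition ideal_of (s : nat) (w : seq nat) : set nat :=
  [set x | x %/ s < nth 0 w (x %% s)].

Lemma ideal_ofE s w q j :
  j < s -> ideal_of s w (q * s + j) = (q < nth 0 w j) :> Prop.
Proof.
move=> js; rewrite /ideal_of /= modnMDl modn_small //.
by rewrite divnMDl ?divn_small ?addn0 //; lia.
Qed.

Lemma height_seq_ideal k w : height_seq k w ->
  order_ideal k.*2.+1 k.*2.+3 (ideal_of k.*2.+1 w) /\
  no_consecutive (ideal_of k.*2.+1 w).
Proof.
set s := k.*2.+1; move=> [sw w0 w1 cw iw].
have coords x : exists q j, j < s /\ x = q * s + j.
  by exists (x %/ s), (x %% s); rewrite ltn_mod -divn_eq.
split; first apply/order_idealP; first split=> [|x|x].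
- by rewrite -[0](addn0 (0 * s)) ideal_ofE // w0.
- have [q [j [js ->]]] := coords x.
  rewrite addnAC -[X in _ * _ + X]mul1n -mulnDl !ideal_ofE //; lia.
- have [q [j [js ->]]] := coords x; rewrite [X in _ -> X]ideal_ofE //.
  (* Adding s+2 moves column j to column j+2 one row up, or, past the last column, to column 0 or 1
     two rows up. For s = 1 there is only column 0, which is empty. *)
  have [j2|j2] := ltnP j.+2 s.
    have -> : q * s + j + s.+2 = q.+1 * s + j.+2 by lia.
    by rewrite ideal_ofE //; have := iw _ j2; lia.
  have [k0|k0] := posnP k.
    have -> : q * s + j + s.+2 = (q + j + 3) * s + 0 by rewrite /s k0; lia.
    by rewrite ideal_ofE // w0.
  have [e|e] := eqVneq j.+2 s.
    have -> : q * s + j + s.+2 = q.+2 * s + 0 by lia.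
    by rewrite ideal_ofE // w0.
  have je : j = k.*2 by lia.
  have -> : q * s + j + s.+2 = q.+2 * s + 1 by lia.
  by rewrite ideal_ofE ?je //; lia.
move=> x; have [q [j [js ->]]] := coords x.
have [j1|j1] := ltnP j.+1 s.
  by rewrite -addnS !ideal_ofE // => -[]; have := cw _ j1; nia.
have -> : (q * s + j).+1 = q.+1 * s + 0 by lia.
by rewrite !ideal_ofE // w0 => -[].
Qed.

Lemma initial_segment (P : nat -> Prop) n :
  (forall q, P q.+1 -> P q) -> ~ P n -> exists h, forall q, P q <-> q < h.
Proof.
move=> PS; have Pdown q d : P (d + q) -> P q by elim: d => // d IHd /PS /IHd.
elim: n => [|n IHn] Pn.
  by exists 0 => q; split=> //; rewrite -[q]addn0 => /Pdown.
have [Pn'|/IHn //] := pselect (P n).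
exists n.+1 => q; split=> [Pq|qn].
  by have [//|nq] := ltnP q n.+1; case: Pn; apply: (Pdown _ (q - n.+1)); rewrite subnK.
by apply: (Pdown _ (n - q)); rewrite subnK.
Qed.

Lemma ideal_height_seq k (I : set nat) :
  order_ideal k.*2.+1 k.*2.+3 I -> no_consecutive I ->
  exists2 w, height_seq k w & ideal_of k.*2.+1 w = I.
Proof.
set s := k.*2.+1 => Iideal Icons; have [IP _] := Iideal.
have [I0 Is It] := (order_idealP _ _ _).1 Iideal.
(* The bound on [j] stands under the existential so that choice yields a function on all of
   [nat]. *)
have hex j : exists h, j < s -> forall q, I (q * s + j) <-> q < h.
  have [js|] := ltnP j s; last by exists 0.
  have [q|Ij|h hP] := @initial_segment (fun q => I (q * s + j)) s; last by exists h.
    by rewrite mulSn addnC addnCA addnC => /Is; rewrite addnC.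
  (* Row s is outside the poset: s*s + 2i = (s-i)*s + i*(s+2). For odd j the even number j + s
     replaces 2i, at the cost of one s. *)
  apply: (IP _ Ij); have [jodd|jeven] := boolP (odd j).
    exists (s - (j + s)./2).-1, (j + s)./2.
    have : j = j./2.*2.+1 by lia.
    by rewrite /s; nia.
  exists (s - j./2), j./2.
  have : j = j./2.*2 by lia.
  by rewrite /s; nia.
pose h j := sval (cid (hex j)).
have hP j : j < s -> forall q, I (q * s + j) <-> q < h j := svalP (cid (hex j)).
have wE j : j < s -> nth 0 (mkseq h s) j = h j by move=> js; rewrite nth_mkseq.
exists (mkseq h s).
  split.
  - by rewrite size_mkseq.
  - by rewrite wE //; apply/eqP; rewrite -leqn0 leqNgt; apply/negP => /(hP 0 isT 0).2.
  - have [k0|k0] := posnP k; first by rewrite nth_default // size_mkseq; lia.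
    rewrite !wE; [|lia..]; rewrite leqNgt; apply/negP => /(hP 1 ltac:(lia) _).2.
    rewrite (_ : _ + 1 = h k.*2 * s + k.*2 + s.+2); last by lia.
    by move=> /It /(hP k.*2 (leqnn _) _).1; rewrite ltnn.
  - move=> j js; rewrite !wE; [|lia..]; apply/eqP; rewrite muln_eq0 -!leqn0.
    have [//|hj] := leqP (h j) 0; have [//|hj1] := leqP (h j.+1) 0.
    case: (Icons j); split; [apply: (hP j _ 0).2|apply: (hP j.+1 _ 0).2]; lia.
  - move=> j js; rewrite !wE; [|lia..]; rewrite leqNgt; apply/negP => /(hP j.+2 js _).2.
    rewrite (_ : _ + j.+2 = h j * s + j + s.+2); last by lia.
    by move=> /It /(hP j ltac:(lia) _).1; rewrite ltnn.
rewrite predeqE => x; rewrite (divn_eq x s) ideal_ofE ?ltn_mod // wE ?ltn_mod //.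
by apply: iff_sym; apply: hP; rewrite ltn_mod.
Qed.

Lemma ideal_of_inj k w w' : height_seq k w -> height_seq k w' ->
  ideal_of k.*2.+1 w = ideal_of k.*2.+1 w' -> w = w'.
Proof.
move=> [sw _ _ _ _] [sw' _ _ _ _] e.
apply: (@eq_from_nth _ 0); [by rewrite sw|move=> j; rewrite sw => js].
have E q : (q < nth 0 w j) = (q < nth 0 w' j).
  by apply/idP/idP; rewrite -(ideal_ofE w q js) -(ideal_ofE w' q js) e.
apply/eqP; rewrite eqn_leq; apply/andP; split.
  by rewrite leqNgt E ltnn.
by rewrite leqNgt -E ltnn.
Qed.

Lemma ideal_of_bij k :
  set_bij [set` height_seqs k]
    [set I | order_ideal k.*2.+1 k.*2.+3 I /\ no_consecutive I]
    (ideal_of k.*2.+1).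
Proof.
split=> [w|w w'|I [Iideal Icons]].
- by move=> /mem_height_seqs /height_seq_ideal.
- by rewrite !inE => /mem_height_seqs hw /mem_height_seqs hw'; exact: ideal_of_inj hw hw'.
- have [w hw <-] := ideal_height_seq Iideal Icons.
  by exists w => //; exact/mem_height_seqs.
Qed.

Theorem theorem1p4 (s : nat) (s_gt0 : (0 < s)%N) (s_odd : odd s) :
  exists f : set nat -> seq (int * int),
    set_bij
      [set I : set nat | order_ideal s s.+2 I /\ no_consecutive I]
      [set p : seq (int * int) | exists2 y : int, (0 < y)%R & lattice_path s y p]
      f.
Proof.
have -> : s = s./2.*2.+1 by lia.
set k := s./2.
(* An ideal goes to its heights, these to the bit sequence at the same position in the other list,
   and that to its path. *)
have inv := bijpinv_bij (fun=> [::]) (ideal_of_bij k).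
have mid := uniq_set_bij [::] (uniq_height_seqs k) (uniq_ups k) (size_height_seqs k).
by eexists; exact: set_bij_comp (set_bij_comp inv mid) (walk_bij k).
Qed.
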